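(* Let $G=(V,E)$ be a connected graph with at least two vertices. Then the lightest tone of $G$ is $lt_G=\frac{1}{\chi(G)-1}$, where $\chi(G)$ is the chromatic number of $G$.
   Context: Graphs are finite, undirected and simple. A greyscale of $G=(V,E)$ is a map $f:V\to[0,1]$ with $0,1\in \mathrm{Im}(f)$. For $e=\{u,v\}\in E$ put $\widehat f(e)=|f(u)-f(v)|$. The contrast vector $cont(G,f)$ is the vector of all values $\widehat f(e)$, $e\in E$, listed in ascending order. Contrast vectors are compared in the lexicographical order, and $cont_{max}(G)$ is the lexicographic maximum of $cont(G,f)$ over all greyscales $f$ of $G$. The lightest tone $lt_G$ is the first component of $cont_{max}(G)$. *)

(* Defs.v *)
From mathcomp Require Import all_boot all_order all_algebra.
From mathcomp Require Import boolp classical_sets reals.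
Set Implicit Arguments.
Unset Strict Implicit.
Unset Printing Implicit Defensive.
Import Order.TTheory GRing.Theory Num.Theory.
Local Open Scope ring_scope.

Record sgraph := SGraph {
  vertex :> finType;
  adj : rel vertex;
  adj_sym : symmetric adj;
  adj_irrefl : irreflexive adj }.

Definition connected_graph (G : sgraph) : Prop :=
  forall u v : G, connect (@adj G) u v.

Definition edges (G : sgraph) : {set {set G}} :=
  [set [set p.1; p.2] | p : G * G & adj p.1 p.2].

Definition colorable (G : sgraph) (k : nat) : bool :=
  [exists c : {ffun G -> 'I_k}, [forall u, forall v, adj u v ==> (c u != c v)]].

Lemma colorable_ex (G : sgraph) : exists k, colorable G k.
Proof.
exists #|G|; apply/existsP; exists [ffun v => enum_rank v].
apply/forallP => u; apply/forallP => v; apply/implyP => uv.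
rewrite !ffunE; apply/eqP => /enum_rank_inj uEv.
by rewrite uEv adj_irrefl in uv.
Qed.

Definition chromatic_number (G : sgraph) : nat := ex_minn (colorable_ex G).

Definition greyscale (R : realType) (G : sgraph) (f : G -> R) : Prop :=
  [/\ forall v, 0 <= f v <= 1, exists v, f v = 0 & exists v, f v = 1].

(* The endpoints of an edge are recovered by choice; by [edge_contrastE] the
   value does not depend on how they are ordered. *)
Definition edge_contrast (R : realType) (G : sgraph) (f : G -> R)
    (A : {set G}) : R :=
  if [pick p : G * G | A == [set p.1; p.2]] is Some p
  then `|f p.1 - f p.2| else 0.

Lemma edge_contrastE (R : realType) (G : sgraph) (f : G -> R) (u v : G) :
  edge_contrast f [set u; v] = `|f u - f v|.
Proof.
rewrite /edge_contrast; case: pickP => [[x y] /= /eqP E|/(_ (u, v))]; last first.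
  by rewrite eqxx.
have : u \in [set x; y] by rewrite -E !inE eqxx.
have : v \in [set x; y] by rewrite -E !inE eqxx orbT.
have : x \in [set u; v] by rewrite E !inE eqxx.
have : y \in [set u; v] by rewrite E !inE eqxx orbT.
rewrite !inE => /orP[]/eqP-> /orP[]/eqP->; rewrite ?eqxx ?orbb ?orbT //.
- by move=> /eqP-> _.
- by rewrite distrC.
- by move=> _ /eqP->.
Qed.

(* [seqlexi R] is [seq R] with the lexicographic order. *)
Definition contrast_vector (R : realType) (G : sgraph) (f : G -> R) :
    seqlexi R :=
  sort <=%R [seq edge_contrast f A | A <- enum (edges G)].

Definition is_cont_max (R : realType) (G : sgraph) (c : seqlexi R) : Prop :=
  (exists2 f : G -> R, greyscale f & c = contrast_vector f) /\
  (forall f : G -> R, greyscale f -> (contrast_vector f <= c)%O).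

(* The default [::] is returned when no maximum exists; the lightest tone would
   then be 0. *)
Definition cont_max (R : realType) (G : sgraph) : seqlexi R :=
  xget ([::] : seqlexi R) (@is_cont_max R G).

Definition lightest_tone (R : realType) (G : sgraph) : R :=
  head 0 (cont_max R G : seq R).

(* Main.v *)
(** With k = chi(G) - 1, an optimal colouring divided by k uses the values 0 and
    1 and separates adjacent vertices by at least 1/k. Conversely, if every edge
    had contrast above 1/k, cutting [0, 1] into k intervals of length 1/k would
    give a k-colouring. These two facts determine the first entry of the
    lexicographic maximum of the contrast vectors once this maximum is known to
    exist. It does by compactness of the set of greyscales, by maximizing one
    coordinate after the other. *)
Require Import Defs.
From mathcomp Require Import all_boot all_order all_algebra.
From mathcomp Require Import boolp classical_sets reals.
From mathcomp Require Import topology normedtype derive lra.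
Set Implicit Arguments.
Unset Strict Implicit.
Unset Printing Implicit Defensive.
Import Order.TTheory GRing.Theory Num.Theory numFieldNormedType.Exports.
Local Open Scope classical_set_scope.
Local Open Scope ring_scope.

(** * Lexicographic maxima on compact sets *)

Definition attains_max d (T : Type) (L : orderType d) (v : T -> L) (A : set T) :=
  exists2 x, A x & forall y, A y -> (v y <= v x)%O.

(** Empty pieces are discarded; of two nonempty ones, the larger maximum is kept, the order being
    total. *)
Lemma attains_max_bigsetU d (T : Type) (L : orderType d) (v : T -> L)
    (J : Type) (r : seq J) (F : J -> set T) :
  (forall j, F j !=set0 -> attains_max v (F j)) ->
  \big[setU/set0]_(j <- r) F j !=set0 ->
  attains_max v (\big[setU/set0]_(j <- r) F j).
Proof.
move=> Fmax; elim: r => [|j r IH]; first by rewrite big_nil => -[].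
rewrite big_cons.
have [->|/set0P/Fmax[x Fx xmax]] := eqVneq (F j) set0; first by rewrite set0U.
have [->|/set0P/IH[z Fz zmax] _] := eqVneq (\big[setU/set0]_(j <- r) F j) set0.
  by rewrite setU0 => _; exists x.
have [xz|zx] := leP (v x) (v z).
  by exists z; [right | move=> y [/xmax yx|/zmax //]; exact: le_trans yx xz].
exists x; [by left|move=> y [/xmax//|/zmax yz]].
exact: le_trans yz (ltW zx).
Qed.

Section CompactLexi.
Variables (R : realType) (X : topologicalType) (I : choiceType) (h : I -> X -> R).
Hypothesis h_cont : forall i, continuous (h i).

(** The extreme value theorem maximizes the first coordinate. Its maximizers form a compact set, on
    which induction maximizes the remaining coordinates. *)
Lemma attains_max_lexi (K : set X) (s : seq I) : K !=set0 -> compact K ->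
  attains_max (fun x => [seq h i x | i <- s] : seqlexi R) K.
Proof.
elim: s K => [|i s IH] K K0 cK; first by case: K0 => x Kx; exists x.
have [x] := compact_EVT_max K0 cK (continuous_subspaceT (@h_cont i)).
rewrite inE => Kx xmax.
(* Inside [K], this superlevel set is exactly the set of maximizers of [h i]. *)
have cl : closed (h i @^-1` [set r | h i x <= r]).
  by apply: closed_comp; [move=> ? _; exact: h_cont | exact: closed_ge].
have [||z [Kz /= hz] zmax] := IH (K `&` h i @^-1` [set r | h i x <= r]).
- by exists x; split => /=.
- exact: compact_closedI.
exists z => // y Ky /=.
have hyx : h i y <= h i x by apply: xmax; rewrite inE.
rewrite lexi_cons (le_trans hyx hz) /=; apply/implyP => hzy.
by apply: zmax; split => //=; exact: le_trans hz hzy.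
Qed.

Lemma closed_sorted (s : seq I) :
  closed [set x | sorted <=%R [seq h i x | i <- s]].
Proof.
case: s => [|i s] /=.
  by rewrite (_ : mkset _ = setT); [exact: closedT | apply/seteqP; split].
elim: s i => [|j s IH] i /=.
  by rewrite (_ : mkset _ = setT); [exact: closedT | apply/seteqP; split].
rewrite (_ : mkset _ = (fun x => h j x - h i x) @^-1` [set r | 0 <= r] `&`
    [set x | path <=%R (h j x) [seq h i x | i <- s]]); last first.
  by apply/seteqP; split => x /=; rewrite subr_ge0 => /andP.
apply: closedI; last exact: IH.
apply: closed_comp; last exact: closed_ge.
by move=> x _; apply: cvgB; exact: h_cont.
Qed.

(* [sort] is not treated as a continuous map: on each of the finitely many
   closed regions where a fixed permutation sorts the values, the sorted vector
   is a tuple of continuous functions. *)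
Lemma attains_max_sort (K : set X) (s : seq I) : K !=set0 -> compact K ->
  attains_max (fun x => sort <=%R [seq h i x | i <- s] : seqlexi R) K.
Proof.
move=> K0 cK.
pose F p := K `&` [set x | perm_eq p s /\ sorted <=%R [seq h i x | i <- p]].
have sortE p x : F p x -> sort <=%R [seq h i x | i <- s] = [seq h i x | i <- p].
  case=> _ [ps sp]; apply: le_sorted_eq; rewrite ?sort_le_sorted //.
  by rewrite perm_sort perm_map // perm_sym.
have KE : \big[setU/set0]_(p <- permutations s) F p = K.
  rewrite -bigcup_seq; apply/seteqP; split => [x [p _ []]//|x Kx].
  (* The regions cover [K]: sorting the indices by their values at [x] yields a region containing
     [x]. *)
  pose p := sort (relpre (h^~ x) <=%R) s.
  have ps : perm_eq p s by rewrite perm_sort.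
  exists p; first by rewrite /= mem_permutations.
  by do 2!split => //; rewrite -sort_map sort_le_sorted.
rewrite -KE; apply: attains_max_bigsetU; last by rewrite KE.
move=> p Fp0; have ps : perm_eq p s by case: Fp0 => x [_ []].
have cF : compact (F p).
  apply: compact_closedI => //; rewrite (_ : mkset _ =
    [set x | sorted <=%R [seq h i x | i <- p]]); first exact: closed_sorted.
  by apply/seteqP; split => x /=; [case | split].
have [x Fx xmax] := attains_max_lexi p Fp0 cF.
exists x => // y Fy; rewrite (sortE _ _ Fx) (sortE _ _ Fy); exact: xmax.
Qed.

End CompactLexi.

(** * Compactness of the greyscales and existence of the maximum *)

Lemma continuous_dist (R : realType) (X : topologicalType) (f g : X -> R) :
  continuous f -> continuous g -> continuous (fun x => `|f x - g x|).
Proof. by move=> cf cg x; apply: cvg_norm; apply: cvgB; [exact: cf|exact: cg]. Qed.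

Lemma ptws_eval_continuous (R : realType) (I : eqType) (i : I) :
  continuous (fun f : {ptws I -> R} => f i).
Proof. exact: (@proj_continuous I (fun=> R) i). Qed.

(** The pair picked depends on [A] alone, so a single formula in two evaluations holds for all
    [f]. *)
Lemma edge_contrast_continuous (R : realType) (G : sgraph) (A : {set G}) :
  continuous (fun f : {ptws G -> R} => edge_contrast f A).
Proof.
rewrite /edge_contrast; case: pickP => [p _|_]; last exact: cst_continuous.
exact: continuous_dist (@ptws_eval_continuous R G p.1)
  (@ptws_eval_continuous R G p.2).
Qed.

(** The cube of maps into [0, 1] is compact by Tychonoff. Taking the value 0, or 1, is a closed
    condition: a union over the finitely many vertices of closed sets. *)
Lemma greyscale_compact (R : realType) (G : sgraph) :
  compact [set f : {ptws G -> R} | greyscale f].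
Proof.
have val_closed (r : R) : closed [set f : {ptws G -> R} | exists v, f v = r].
  rewrite (_ : mkset _ = \big[setU/set0]_(v <- enum G)
    (fun f : {ptws G -> R} => f v) @^-1` [set x | x = r]); last first.
    rewrite -bigcup_seq; apply/seteqP; split => f [v].
      by move=> fv; exists v; rewrite //= mem_enum.
    by move=> _ fv; exists v.
  apply: closed_bigsetU => v _; apply: closed_comp; last exact: closed_eq.
  by move=> f _; exact: ptws_eval_continuous.
rewrite (_ : mkset _ = [set f : {ptws G -> R} | forall v, f v \in `[0, 1]] `&`
    [set f : {ptws G -> R} | exists v, f v = 0] `&`
    [set f : {ptws G -> R} | exists v, f v = 1]); last first.
  by apply/seteqP; split => f /= => [[f01 ? ?]|[[f01 ? ?]]]; do ?split => // v;
    move: (f01 v); rewrite in_itv.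
do 2!apply: compact_closedI => //.
exact: (@tychonoff G (fun=> R) (fun=> [set` `[0, 1]]) (fun=> @segment_compact _ _ _)).
Qed.

(** The given [f] shows that the set of greyscales is nonempty, so the maximum is attained and
    [xget] does not return its default. *)
Lemma cont_max_is_max (R : realType) (G : sgraph) (f : G -> R) :
  greyscale f -> is_cont_max G (cont_max R G).
Proof.
move=> gf; apply: xgetPex.
have [] := @attains_max_sort R {ptws G -> R} _ _
  (@edge_contrast_continuous R G) [set f | greyscale f] (enum (edges G)).
- by exists f.
- exact: greyscale_compact.
by move=> x gx xmax; exists (contrast_vector x); split; [exists x|].
Qed.


(** * The first entry of a contrast vector *)

Lemma mem_edges (G : sgraph) (u v : G) :
  adj u v -> [set u; v]%SET \in edges G.
Proof. by move=> uv; apply/imsetP; exists (u, v); rewrite ?inE. Qed.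

Lemma contrast_vector_neq0 (R : realType) (G : sgraph) (f : G -> R) (u v : G) :
  adj u v -> contrast_vector f != [::].
Proof.
move=> uv; rewrite -size_eq0 size_sort size_map -cardE cards_eq0.
by apply/set0Pn; exists [set u; v]%SET; exact: mem_edges.
Qed.

Lemma head_contrast_vector_le (R : realType) (G : sgraph) (f : G -> R) (u v : G) :
  adj u v -> head 0 (contrast_vector f) <= `|f u - f v|.
Proof.
move=> uv; rewrite -edge_contrastE.
have : edge_contrast f [set u; v]%SET \in contrast_vector f.
  rewrite mem_sort; apply: map_f; rewrite mem_enum.
  exact: mem_edges.
have : sorted <=%R (contrast_vector f) by exact: sort_le_sorted.
case: (contrast_vector f) => [//|x s] /= xs; rewrite inE => /predU1P[->//|].
by move/(allP (order_path_min le_trans xs)).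
Qed.

(** The edge between [u] and [v] makes the vector nonempty, so its head is the contrast of some edge
    and not the default 0. *)
Lemma head_contrast_vector_ge (R : realType) (G : sgraph) (f : G -> R) t (u v : G) :
  adj u v -> (forall x y : G, adj x y -> t <= `|f x - f y|) ->
  t <= head 0 (contrast_vector f).
Proof.
move=> /(contrast_vector_neq0 f) cv0 tle.
have : head 0 (contrast_vector f) \in contrast_vector f.
  by case: (contrast_vector f) cv0 => //= x s _; rewrite mem_head.
rewrite mem_sort => /mapP[A + ->].
rewrite mem_enum => /imsetP[[x y] /[!inE] xy ->].
by rewrite edge_contrastE; exact: tle.
Qed.

(** Since [s] is nonempty, so is [t], and both heads are genuine entries. *)
Lemma lexi_head (R : realType) (s t : seqlexi R) :
  (s <= t)%O -> s != [::] -> head 0 s <= head 0 t.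
Proof.
by case: s t => [|x s] [|y t] //; rewrite lexi_cons => /andP[].
Qed.

(** * Colourings and the two bounds on edge contrasts *)

Lemma colorableP (G : sgraph) k :
  reflect (exists c : G -> 'I_k, forall u v : G, adj u v -> c u != c v)
    (colorable G k).
Proof.
apply: (iffP existsP) => [[c /'forall_forallP cP]|[c cP]].
  by exists c => u v uv; move/implyP: (cP u v); apply.
exists (finfun c); apply/'forall_forallP => u v; apply/implyP => uv.
by rewrite !ffunE cP.
Qed.

Lemma chromatic_colorable (G : sgraph) : colorable G (chromatic_number G).
Proof. by rewrite /chromatic_number; case: ex_minnP. Qed.

Lemma chromatic_number_min (G : sgraph) k :
  colorable G k -> (chromatic_number G <= k)%N.
Proof. by rewrite /chromatic_number; case: ex_minnP => m _; apply. Qed.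

(** If colour [i] were missed, renumbering the others through [lift i] would save a colour. *)
Lemma optimal_coloring_surj (G : sgraph) n (c : G -> 'I_n.+1) :
  chromatic_number G = n.+1 -> (forall u v : G, adj u v -> c u != c v) ->
  forall i, exists v, c v = i.
Proof.
move=> chiE cP i; apply: contrapT => nci.
have : colorable G n.
  apply/colorableP.
  have ex v : exists j, c v = lift i j.
    case: (unliftP i (c v)) => [j ->|cvi]; first by exists j.
    by case: nci; exists v.
  have [c' c'E] := choice ex; exists c' => u v /cP.
  by apply: contraNN => /eqP; rewrite !c'E => ->.
by move/chromatic_number_min; rewrite chiE ltnn.
Qed.

Lemma connected_edge (G : sgraph) :
  connected_graph G -> (1 < #|G|)%N -> exists u v : G, adj u v.
Proof.
move=> Gc /card_gt1P[x [y [_ _ xy]]].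
have /connectP[[|z p] /= ] := Gc x y; first by move=> _ yx; rewrite yx eqxx in xy.
by case/andP => xz _ _; exists x, z.
Qed.

Lemma chromatic_number_gt1 (G : sgraph) (u v : G) :
  adj u v -> (1 < chromatic_number G)%N.
Proof.
move=> uv; have := chromatic_colorable G.
case: (chromatic_number G) => [|[|//]] /colorableP[c cP].
  by case: (c u).
by move: (cP _ _ uv); rewrite !ord1 eqxx.
Qed.

(* Vertices with values in the same interval [i/k, (i+1)/k] get colour i. *)
Lemma high_contrast_colorable (R : realType) (G : sgraph) (f : G -> R) k :
  (0 < k)%N -> (forall v, 0 <= f v <= 1) ->
  (forall u v : G, adj u v -> 1 / k%:R < `|f u - f v|) -> colorable G k.
Proof.
move=> k0 f01 fhigh; have k0R : 0 < k%:R :> R by rewrite ltr0n.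
have ex v : exists i : 'I_k, i%:R <= f v * k%:R <= i%:R + 1.
  have /andP[f0 f1] := f01 v.
  have /truncn_itv : 0 <= f v * k%:R by rewrite mulr_ge0 // ltW.
  set i := Num.trunc _ => /andP[ile ilt].
  have [ik|ki] := ltnP i k.
    by exists (Ordinal ik); rewrite /= ile natr1 ltW.
  (* Here [f v] must be 1, the right end of the last interval, so the colour is [k.-1]. *)
  have pk : (k.-1 < k)%N by rewrite ltn_predL.
  exists (Ordinal pk); rewrite /= natr1 prednK //; apply/andP; split.
    by apply: le_trans ile; rewrite ler_nat (leq_trans (ltnW pk)).
  by rewrite ler_piMl // ltW.
have [c cP] := choice ex; apply/colorableP; exists c => u v uv.
(* Two values in one interval of length 1/k differ by at most 1/k, against [fhigh]. *)
apply/eqP => cuv; have := fhigh _ _ uv; apply/negP; rewrite -leNgt.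
rewrite ler_pdivlMr // -(gtr0_norm k0R) -normrM mulrBl ler_norml.
move: (cP u) (cP v); rewrite cuv => /andP[? ?] /andP[? ?].
by apply/andP; split; lra.
Qed.

(** Otherwise the interval colouring would use one colour less than the chromatic number. *)
Lemma low_contrast_edge (R : realType) (G : sgraph) (f : G -> R) :
  (1 < chromatic_number G)%N -> greyscale f ->
  exists u v : G, adj u v /\
    `|f u - f v| <= 1 / ((chromatic_number G)%:R - 1).
Proof.
move=> chi1 [f01 _ _]; apply: contrapT => no.
have : colorable G (chromatic_number G).-1.
  apply: (@high_contrast_colorable R _ f) => // [|u v uv].
    by rewrite -subn1 subn_gt0.
  rewrite -subn1 natrB ?(ltnW chi1) // ltNge; apply/negP => le.
  by apply: no; exists u, v.
by move/chromatic_number_min; rewrite leqNgt ltn_predL (ltnW chi1).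
Qed.

Lemma coloring_greyscale (R : realType) (G : sgraph) :
  (1 < chromatic_number G)%N ->
  exists2 f : G -> R, greyscale f & forall u v : G, adj u v ->
    1 / ((chromatic_number G)%:R - 1) <= `|f u - f v|.
Proof.
have /colorableP := chromatic_colorable G.
case chiE : (chromatic_number G) => [|[|n]] // [c cP] _.
have n0 : 0 < n.+1%:R :> R by rewrite ltr0n.
have surj := optimal_coloring_surj chiE cP.
(* There are n + 2 colours, from 0 to n + 1. Both extremes occur by surjectivity, and distinct
   colours differ by at least 1. *)
exists (fun v => (c v)%:R / n.+1%:R); first split.
- move=> v; rewrite divr_ge0 ?ler0n //= ler_pdivrMr // mul1r ler_nat.
  by rewrite -ltnS.
- by have [v cv] := surj ord0; exists v; rewrite cv mul0r.
- by have [v cv] := surj ord_max; exists v; rewrite cv divff // gt_eqF.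
move=> u v /cP; rewrite -(inj_eq val_inj) /= => cuv.
have -> : n.+2%:R - 1 = n.+1%:R :> R by rewrite -natr1 addrK.
rewrite -mulrBl normrM (gtr0_norm (_ : 0 < _^-1)) ?invr_gt0 //.
rewrite ler_pM2r ?invr_gt0 //.
have [lt|lt|/eqP] := ltngtP (c u) (c v); last by rewrite (negPf cuv).
  by rewrite distrC -natrB ?(ltnW lt) // normr_nat ler1n subn_gt0.
by rewrite -natrB ?(ltnW lt) // normr_nat ler1n subn_gt0.
Qed.

Theorem theorem3p5 (R : realType) (G : sgraph)
    (Gconn : connected_graph G) (Gcard : (1 < #|G|)%N) :
  lightest_tone R G = 1 / ((chromatic_number G)%:R - 1).
Proof.
have [u [v uv]] := connected_edge Gconn Gcard.
have chi1 := chromatic_number_gt1 uv.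
have [g gP gge] := coloring_greyscale R chi1.
have [[f fP fE] cmax] := cont_max_is_max gP.
apply/eqP; rewrite eq_le /lightest_tone; apply/andP; split.
  (* Upper bound: the maximizer [f] itself has an edge of low contrast. *)
  have [x [y [xy]]] := low_contrast_edge chi1 fP.
  by apply: le_trans; rewrite fE; exact: head_contrast_vector_le.
(* Lower bound: the contrast vector of the colouring greyscale [g] is at most the maximum, hence so
   is its head. *)
apply: le_trans (head_contrast_vector_ge uv gge) _.
exact: lexi_head (cmax _ gP) (contrast_vector_neq0 _ uv).
Qed.
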